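(* Let $\mu$ be a probability measure on $\Omega$ satisfying (A1), (A2) and (A3). Let $\mathcal{A}$ be the event that the number of infinite clusters (infinite $0$-clusters and infinite $1$-clusters together) is nonzero and finite. Then $\mu(\mathcal{A})=0$.
   Context: Let $G$ be the square grid with vertex set $\mathbb{Z}^2$, where $(m,n)$ and $(m',n')$ are adjacent iff $|m-m'|+|n-n'|=1$. Each face of $G$ is a unit square; the face whose lower-left corner is $(m,n)$ is called black if $m+n$ is even and white if $m+n$ is odd. Let $\Omega\subset\{0,1\}^{\mathbb{Z}^2}$ be the set of configurations $\omega$ such that, for every black face, the states of its four vertices listed clockwise starting from the lower-left corner form one of the words $0000,1111,0011,1100,0110,1001$. A cluster of $\omega$ is a maximal set of vertices which is connected in $G$ and on which $\omega$ is constant; it is a $0$-cluster or $1$-cluster according to that state, and infinite if it has infinitely many vertices. Assumptions on a probability measure $\mu$ on $\Omega$: (A1) $\mu$ is invariant under the translations of $\mathbb{Z}^2$ by the subgroup generated by $(1,1)$ and $(1,-1)$; (A2) $\mu$ is $2\mathbb{Z}\times 2\mathbb{Z}$-ergodic, i.e. every event invariant under translations by $2\mathbb{Z}\times2\mathbb{Z}$ has probability $0$ or $1$; (A3) $\mu$ is invariant under the map $\theta(\omega)(v)=1-\omega(v)$. *)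

(* Defs.v *)
From HB Require Import structures.
From mathcomp Require Import all_boot all_order all_algebra.
From mathcomp Require Import all_classical all_reals all_analysis.
Set Implicit Arguments. Unset Strict Implicit. Unset Printing Implicit Defensive.
Import Order.TTheory GRing.Theory Num.Theory.
Local Open Scope classical_set_scope.
Local Open Scope ring_scope.

Definition vertex := (int * int)%type.

(* configurations {0,1}^{Z^2}; state 1 is [true], state 0 is [false] *)
Definition config := vertex -> bool.

Definition cylinders : set (set config) :=
  [set A | exists (v : vertex) (b : bool), A = [set w : config | w v = b]].

Definition Config := g_sigma_algebraType cylinders.

Definition adj (x y : vertex) : bool :=
  (absz (x.1 - y.1) + absz (x.2 - y.2) == 1)%N.

(* the face with lower-left corner (m,n) is black iff m+n is even *)
Definition black (m n : int) : bool := ~~ odd (absz (m + n)).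

Definition allowed (a b c d : bool) : bool :=
  (a, b, c, d) \in [:: (false, false, false, false); (true, true, true, true);
                       (false, false, true, true); (true, true, false, false);
                       (false, true, true, false); (true, false, false, true)].

(* Omega: for every black face, the states of its vertices read clockwise
   from the lower-left corner, i.e. (m,n), (m,n+1), (m+1,n+1), (m+1,n),
   form an allowed word *)
Definition Omega : set config :=
  [set w | forall m n : int, black m n ->
     allowed (w (m, n)) (w (m, n + 1)) (w (m + 1, n + 1)) (w (m + 1, n))].

Definition translate (z : vertex) (w : config) : config :=
  fun v => w (v.1 + z.1, v.2 + z.2).

Definition flip (w : config) : config := fun v => ~~ w v.

Definition same_cluster (w : config) (u v : vertex) : Prop :=
  exists s : seq vertex,
    path adj u s /\ last u s = v /\ all (fun x => w x == w u) s.

Definition is_cluster (w : config) (C : set vertex) : Prop :=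
  exists u : vertex, C = [set v | same_cluster w u v].

Definition infinite_clusters (w : config) : set (set vertex) :=
  [set C | is_cluster w C /\ ~ finite_set C].

Definition event_A : set config :=
  [set w | infinite_clusters w !=set0 /\ finite_set (infinite_clusters w)].

(* Main.v *)
(* Every edge of the grid borders exactly one white face, and the white faces
   are of two types, according to the parity of their abscissa. Let [link b] be
   the grid with the state-changing edges bordering a white face of one type
   removed. The two graphs [link true] and [link false] together cover the grid,
   and their intersection is the graph whose components are the clusters. Since
   the plane is simply connected, Mayer-Vietoris (with F_2 coefficients) shows
   that the bipartite graph whose vertices are the components of the two graphs
   and whose edges are the clusters is a tree. Since the grid is one-ended, a
   cluster separating two infinite components is infinite, so the infinite
   components and the infinite clusters again form a tree. Hence, if there are
   N infinite clusters, with N finite and nonzero, and a_b infinite components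
   of [link b], then N + 1 = a_true + a_false. By ergodicity all these numbers
   are almost surely constant; translation by (1,1) exchanges the two types, so
   a_true = a_false, and the flip symmetry makes N even: a contradiction. *)
Require Import Defs.
From HB Require Import structures.
From mathcomp Require Import all_boot all_order all_algebra.
From mathcomp Require Import all_classical all_reals all_analysis.
From mathcomp Require Import zify.
Set Implicit Arguments.
Unset Strict Implicit.
Unset Printing Implicit Defensive.
Import Order.TTheory GRing.Theory Num.Theory.
Local Open Scope classical_set_scope.
Local Open Scope ring_scope.

(** * Cochains on the grid *)

Definition par (z : int) : bool := odd `|z|%N.

Lemma par_add1 (z : int) : par (z + 1) = ~~ par z.
Proof.
rewrite /par; case: z => n.
  by have -> : n%:Z + 1 = n.+1 by lia.
have -> : Negz n + 1 = - n%:Z by lia.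
by rewrite abszN /= negbK.
Qed.

Lemma int_indS (P : int -> Prop) :
  P 0 -> (forall z, P z <-> P (z + 1)) -> forall z, P z.
Proof.
move=> P0 PS; elim/int_ind => // n IH.
  have -> : n.+1%:Z = n%:Z + 1 by lia.
  exact: (proj1 (PS n)).
apply: (proj2 (PS _)); have -> : - n.+1%:Z + 1 = - n%:Z by lia.
exact: IH.
Qed.

Lemma par_add (m n : int) : par (m + n) = par m (+) par n.
Proof.
elim/int_indS: m => [|m]; first by rewrite add0r.
rewrite addrAC !par_add1 addNb; split=> [->//|].
exact: negb_inj.
Qed.

(* The type of the white face bordering an edge: [true] if its lower-left corner
   is (even, odd). *)
Definition tau (u v : vertex) : bool :=
  if u.2 == v.2 then ~~ par (Num.min u.1 v.1) else par (Num.min u.2 v.2).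

Lemma tauC u v : tau u v = tau v u.
Proof. by rewrite /tau eq_sym minC (minC u.2). Qed.

Lemma tau_right m n : tau (m, n) (m + 1, n) = ~~ par m.
Proof. by rewrite /tau /= eqxx min_l // lerDl. Qed.

Lemma tau_up m n : tau (m, n) (m, n + 1) = par n.
Proof. by rewrite /tau /= lt_eqF ?ltrDl // min_l // lerDl. Qed.

Lemma adjC u v : adj u v = adj v u.
Proof. by rewrite /adj -abszN opprB -(abszN (u.2 - _)) opprB. Qed.

Lemma adj_right m n : adj (m, n) (m + 1, n).
Proof. by rewrite /adj /=; lia. Qed.

Lemma adj_up m n : adj (m, n) (m, n + 1).
Proof. by rewrite /adj /=; lia. Qed.

Lemma adj_ind (P : vertex -> vertex -> Prop) :
  (forall u v, P u v -> P v u) ->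
  (forall m n, P (m, n) (m + 1, n)) -> (forall m n, P (m, n) (m, n + 1)) ->
  forall u v, adj u v -> P u v.
Proof.
move=> Ps Pr Pu [m n] [m' n']; rewrite /adj /= => h.
have [[-> ->]|[[-> ->]|[[-> ->]|[-> ->]]]] :
  (m' = m + 1 /\ n' = n) \/ (m = m' + 1 /\ n = n') \/
  (m' = m /\ n' = n + 1) \/ (m = m' /\ n = n' + 1) by lia.
- exact: Pr. - exact/Ps/Pr. - exact: Pu. - exact/Ps/Pu.
Qed.

Lemma integrate_line (q : int -> bool) :
  exists F : int -> bool, forall z, F (z + 1) = F z (+) q z.
Proof.
pose F z := match z with
  | Posz n => \big[addb/false]_(i < n) q i%:Z
  | Negz n => \big[addb/false]_(i < n.+1) q (Negz i) end.
exists F => -[n|[|n]].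
- have -> : n%:Z + 1 = n.+1 by lia.
  by rewrite /= big_ord_recr.
- by rewrite /= big_ord_recr big_ord0 /= addbb big_ord0.
- have -> : Negz n.+1 + 1 = Negz n by lia.
  by rewrite /= [in RHS]big_ord_recr /= addbK.
Qed.

(* The plane is simply connected: a closed F_2-valued 1-cochain is exact. *)
Lemma integrate_grid (h v : int -> int -> bool) :
  (forall m n, h m n (+) v (m + 1) n = v m n (+) h m (n + 1)) ->
  exists f : vertex -> bool,
    (forall m n, f (m + 1, n) = f (m, n) (+) h m n) /\
    (forall m n, f (m, n + 1) = f (m, n) (+) v m n).
Proof.
move=> closed.
have [F FS] := integrate_line (h ^~ 0).
have /choice[V VS] := fun m => integrate_line (v m).
(* Integration along the horizontal axis, then along a column; [V u.1 0] makes the column part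
   vanish on the axis. There the horizontal increments are right by choice of [F], and [closed]
   carries them from row to row. *)
pose f (u : vertex) := F u.1 (+) V u.1 u.2 (+) V u.1 0.
have fv m n : f (m, n + 1) = f (m, n) (+) v m n.
  by rewrite /f /= VS addbA [RHS]addbAC.
exists f; split=> // m; apply: int_indS => [|n].
  by rewrite /f /= !addbK.
rewrite !fv; have := closed m n.
by split; move: H;
  case: (f (m + 1, n)) (f (m, n)) (h m n) (v (m + 1) n) (v m n) (h m (n + 1))
  => [] [] [] [] [] [].
Qed.

Lemma const_line (q : int -> bool) :
  (forall z, q (z + 1) = q z) -> forall z z', q z = q z'.
Proof.
move=> qS; have q0 z : q z = q 0 by elim/int_indS: z => // z; rewrite qS.
by move=> z z'; rewrite !q0.
Qed.

(** Infinitude as escape from every finite list: the quantifiers run over countable types, which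
    later yields measurability. *)
Definition infset (P : vertex -> Prop) : Prop :=
  forall s : seq vertex, exists2 v, v \notin s & P v.

Lemma seq_bounded (s : seq vertex) : exists n : nat,
  forall v, v \in s -> (`|v.1|%N <= n)%N && (`|v.2|%N <= n)%N.
Proof.
elim: s => [|u s [n IH]]; first by exists 0%N.
exists (maxn n (maxn `|u.1|%N `|u.2|%N)) => v.
rewrite !leq_max inE => /orP[/eqP->|/IH/andP[-> ->] //].
by rewrite !leqnn !orbT.
Qed.

Lemma infset_unbounded (P : vertex -> Prop) (n : nat) :
  infset P -> exists2 v, P v & (n < `|v.1|)%N || (n < `|v.2|)%N.
Proof.
move=> Pinf.
pose zs := [seq i%:Z | i <- iota 0 n.+1] ++ [seq - i%:Z | i <- iota 0 n.+1].
have zsP z : (`|z| <= n)%N -> z \in zs.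
  move=> zn; rewrite mem_cat; apply/orP.
  have [z0|z0] := leP 0 z; [left|right]; apply/mapP; exists `|z|%N;
    rewrite ?mem_iota ?add0n ?ltnS ?zn //; first by rewrite gez0_abs.
  by rewrite ltz0_abs // opprK.
have [v vs Pv] := Pinf [seq (x, y) | x <- zs, y <- zs].
exists v => //; rewrite !ltnNge -negb_and; apply: contra vs => /andP[v1 v2].
by apply/allpairsP; exists v; rewrite !zsP //; case: v {v1 v2 Pv}.
Qed.

(** Outside a box containing [s], any two vertices are joined by rows and columns that avoid the
    box, so [f] is constant there and one of its level sets is confined to the box. *)
Lemma one_ended (f : vertex -> bool) (s : seq vertex) :
  (forall u v, adj u v -> u \notin s -> v \notin s -> f u = f v) ->
  ~ (infset (fun v => f v) /\ infset (fun v => ~~ f v)).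
Proof.
move=> fs [ft ff].
have [n nP] := seq_bounded s.
have out v : (n < `|v.1|)%N || (n < `|v.2|)%N -> v \notin s.
  by apply: contraL => /nP; rewrite negb_or -!leqNgt.
have row y x x' : (n < `|y|)%N -> f (x, y) = f (x', y).
  move=> ny; apply: (@const_line (fun x => f (x, y))) => {x x'} x.
  by apply/esym/fs; rewrite ?adj_right ?out //= ny orbT.
have col x y y' : (n < `|x|)%N -> f (x, y) = f (x, y').
  move=> nx; apply: (@const_line (fun y => f (x, y))) => {y y'} y.
  by apply/esym/fs; rewrite ?adj_up ?out //= nx.
pose N : int := n.+1%:Z.
have far v : (n < `|v.1|)%N || (n < `|v.2|)%N -> f v = f (N, N).
  case: v => x y /= /orP[nx|ny].
    by rewrite (col x y N) // (row N x N) // /N; lia.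
  by rewrite (row y x N) // (col N y N) // /N; lia.
have [v fv /far] := infset_unbounded n ft.
have [v' fv' /far] := infset_unbounded n ff.
by move=> e; rewrite fv -e (negbTE fv').
Qed.

(** * Components *)

Definition conn (e : rel vertex) (u v : vertex) : Prop :=
  exists2 s, path e u s & last u s = v.

Definition infc (e : rel vertex) (u : vertex) : Prop := infset (conn e u).

Section Connectivity.
Variable e : rel vertex.

Lemma conn_refl u : conn e u u.
Proof. by exists [::]. Qed.

Lemma conn_trans u v x : conn e u v -> conn e v x -> conn e u x.
Proof.
move=> [s us <-] [t vt <-]; exists (s ++ t); last by rewrite last_cat.
by rewrite cat_path us.
Qed.

Lemma conn1 u v : e u v -> conn e u v.
Proof. by exists [:: v] => //=; rewrite andbT. Qed.

Lemma conn_const (T : Type) (f : vertex -> T) :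
  (forall u v, e u v -> f u = f v) -> forall u v, conn e u v -> f u = f v.
Proof.
move=> fe u v [s]; elim: s u => [|x s IH] u /=; first by move=> _ ->.
by move=> /andP[/fe-> xs] /IH; apply.
Qed.

Hypothesis eC : symmetric e.

Lemma conn_sym u v : conn e u v -> conn e v u.
Proof.
move=> [s]; elim: s u => [|x s IH] u /=; first by move=> _ ->; exact: conn_refl.
move=> /andP[ux xs] /(IH _ xs) vx; apply: conn_trans vx _.
by apply: conn1; rewrite eC.
Qed.

Lemma conn_eql u v x : conn e u v -> `[< conn e u x >] = `[< conn e v x >].
Proof.
move=> uv; apply/asboolP/asboolP; first exact: conn_trans (conn_sym uv).
exact: conn_trans uv.
Qed.

Lemma conn_eqr u v x : conn e u v -> `[< conn e x u >] = `[< conn e x v >].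
Proof.
move=> uv; apply/asboolP/asboolP => xu; apply: conn_trans xu _ => //.
exact: conn_sym.
Qed.

Lemma infc_conn u v : conn e u v -> infc e u -> infc e v.
Proof.
move=> uv iu s; have [x xs ux] := iu s; exists x => //.
exact: conn_trans (conn_sym uv) ux.
Qed.

End Connectivity.

Lemma conn_sub (e e' : rel vertex) u v : subrel e e' -> conn e u v -> conn e' u v.
Proof. by move=> ee' [s us sv]; exists s => //; apply: sub_path us. Qed.

Lemma infc_sub (e e' : rel vertex) u : subrel e e' -> infc e u -> infc e' u.
Proof.
move=> ee' iu s; have [x xs ux] := iu s; exists x => //; exact: conn_sub ux.
Qed.

Lemma conn_adj u v : conn adj u v.
Proof.
suff c0 y : conn adj (0, 0) y by exact: conn_trans (conn_sym adjC (c0 u)) (c0 v).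
have step x y' : adj x y' -> conn adj (0, 0) x <-> conn adj (0, 0) y'.
  move=> xy; split=> c; apply: conn_trans c _; apply: conn1 => //.
  by rewrite adjC.
move: y => [m n]; elim/int_indS: n => [|n]; last exact/step/adj_up.
elim/int_indS: m => [|m]; [exact: conn_refl | exact/step/adj_right].
Qed.

(** * The graph of clusters and the two graphs covering the grid *)

Definition mono (w : config) : rel vertex := fun u v => adj u v && (w u == w v).

Definition link (b : bool) (w : config) : rel vertex :=
  fun u v => adj u v && ((w u == w v) || (tau u v == b)).

Lemma monoC w : symmetric (mono w).
Proof. by move=> u v; rewrite /mono adjC eq_sym. Qed.

Lemma linkC b w : symmetric (link b w).
Proof. by move=> u v; rewrite /link adjC eq_sym tauC. Qed.

Lemma mono_link b w : subrel (mono w) (link b w).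
Proof. by move=> u v /andP[uv wuv]; rewrite /link uv wuv. Qed.

Lemma link_total b w u v : adj u v -> link b w u v || link (~~ b) w u v.
Proof. by rewrite /link => ->; case: b (tau u v) (w u == w v) => [] [] []. Qed.

Lemma conn_mono_state w u v : conn (mono w) u v -> w u = w v.
Proof. by apply: conn_const => x y /andP[_ /eqP]. Qed.

(* Mayer-Vietoris: the cochain [~~ tau u v && (chi u (+) chi v)] is the image
   of [chi] under the connecting map. It is closed on white faces because [tau]
   is constant there, and on black faces because of the local constraint. *)
Lemma split_function (w : config) (chi : vertex -> bool) : Omega w ->
  (forall u v, mono w u v -> chi u = chi v) ->
  exists f : vertex -> bool, forall u v, adj u v ->
    f u (+) f v = ~~ tau u v && (chi u (+) chi v).
Proof.
move=> Ow chiw.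
pose h m n := par m && (chi (m, n) (+) chi (m + 1, n)).
pose v m n := ~~ par n && (chi (m, n) (+) chi (m, n + 1)).
have closed m n : h m n (+) v (m + 1) n = v m n (+) h m (n + 1).
  (* Each allowed word gives equal states along two parallel edges of the face, so the four values
     of [chi] sum to 0. *)
  have corner : black m n ->
      chi (m, n) (+) chi (m + 1, n) = chi (m, n + 1) (+) chi (m + 1, n + 1).
    move=> /Ow ok.
    have : (w (m, n) == w (m, n + 1)) && (w (m + 1, n) == w (m + 1, n + 1))
        || (w (m, n) == w (m + 1, n)) && (w (m, n + 1) == w (m + 1, n + 1)).
      move: ok; move: (w (m, n)) (w (m, n + 1)) (w (m + 1, n + 1)) (w (m + 1, n)).
      by move=> [] [] [] [].
    case/orP=> /andP[e1 e2].
      have -> : chi (m, n) = chi (m, n + 1) by apply: chiw; rewrite /mono adj_up.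
      by congr (_ (+) _); apply: chiw; rewrite /mono adj_up.
    have -> : chi (m, n) = chi (m + 1, n) by apply: chiw; rewrite /mono adj_right.
    rewrite addbb; suff -> : chi (m, n + 1) = chi (m + 1, n + 1) by rewrite addbb.
    by apply: chiw; rewrite /mono adj_right.
  (* On a white face the four edges carry all of the increments of [chi], or none; on a black face
     only two parallel edges count, and [corner] cancels them. *)
  rewrite /h /v; move: corner; rewrite /black -/(par _) par_add.
  move: (chi (m, n)) (chi (m + 1, n)) (chi (m, n + 1)) (chi (m + 1, n + 1)).
  by case: (par m) (par n) => [] [] [] [] [] [] // /(_ isT).
have [f [fr fu]] := integrate_grid closed.
exists f; apply: adj_ind => [x y|m n|m n].
- by rewrite addbC (addbC (chi x)) tauC.
- by rewrite fr tau_right negbK addKb.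
- by rewrite fu tau_up addKb.
Qed.

(** * Separation of infinite components *)

Section Separation.
Variables (w : config) (chi f : vertex -> bool).
Hypothesis chiw : forall u v, mono w u v -> chi u = chi v.
Hypothesis fchi :
  forall u v, adj u v -> f u (+) f v = ~~ tau u v && (chi u (+) chi v).

(** The two functions [f] and [f (+) chi] whose sum is [chi]: the first jumps only across edges of
    type [false], the second only across edges of type [true], so each is constant on the components
    of its own graph. *)
Definition side (b : bool) (u : vertex) : bool := f u (+) (~~ b && chi u).

Lemma side_link b u v : link b w u v -> side b u = side b v.
Proof.
rewrite /link /side => /andP[uv].
have := fchi uv; have := @chiw u v; rewrite /mono uv /=.
case: (w u == w v) => /= [/(_ isT) ->|_].
  by rewrite addbb andbF; case: b (f u) (f v) (chi v) => [] [] [] [].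
move=> + /eqP <-.
by case: (tau u v) (f u) (f v) (chi u) (chi v) => [] [] [] [] [].
Qed.

Lemma side_conn b u v : conn (link b w) u v -> side b u = side b v.
Proof. by apply: conn_const; apply: side_link. Qed.

Lemma sideC b u : chi u -> side b u != side (~~ b) u.
Proof. by rewrite /side => ->; case: b (f u) => [] []. Qed.

Lemma side_off b u : ~~ chi u -> side b u = f u.
Proof. by rewrite /side => /negbTE->; rewrite andbF addbF. Qed.

(** If [chi] vanished off a finite list, [f] would be locally constant there. Each infinite
    component provides infinitely many vertices where [f] equals its side, so distinct sides would
    contradict [one_ended]. *)
Lemma side_sep b b' u v : infc (link b w) u -> infc (link b' w) v ->
  side b u != side b' v -> infset (fun x => chi x).
Proof.
move=> iu iv /eqP ne; apply: contrapT => /existsNP[s sP].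
have chis x : x \notin s -> ~~ chi x.
  by move=> xs; apply/negP => cx; apply: sP; exists x.
have level b1 x : infc (link b1 w) x -> infset (fun y => f y = side b1 x).
  move=> ix t; have [y] := ix (s ++ t); rewrite mem_cat negb_or => /andP[ys yt].
  by move=> /side_conn ->; exists y => //; rewrite side_off // chis.
apply: (@one_ended f s) => [x y xy xs ys|].
  have := fchi xy; rewrite (negbTE (chis _ xs)) (negbTE (chis _ ys)) andbF.
  by case: (f x) (f y) => [] [].
have := level _ _ iu; have := level _ _ iv; move: ne.
case: (side b u) (side b' v) => [] [] // _ lv lu; split=> t.
- by have [y yt fy] := lu t; exists y; rewrite ?fy.
- by have [y yt fy] := lv t; exists y; rewrite ?fy.
- by have [y yt fy] := lv t; exists y; rewrite ?fy.
- by have [y yt fy] := lu t; exists y; rewrite ?fy.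
Qed.
End Separation.

(* Mayer-Vietoris for infinite components: exactness in the middle. Along a
   path between two infinite components, if the initial cluster is not visited
   again and the first step leaves the initial component, then this cluster
   separates the two components, hence is infinite. *)
Lemma gluing (w : config) (val : bool -> vertex -> bool) : Omega w ->
  (forall b u v, conn (link b w) u v -> val b u = val b v) ->
  (forall u, infc (mono w) u -> val true u = val false u) ->
  forall b b' u v, infc (link b w) u -> infc (link b' w) v ->
    val b u = val b' v.
Proof.
move=> Ow valc vali b b' u v iu iv.
have valC b1 x : infc (mono w) x -> val b1 x = val (~~ b1) x.
  by move=> /vali; case: b1 => /= ->.
have [s us sv] := conn_adj u v.
have [n] := ubnP (size s); elim: n => // n IH in s b u us sv iu *; rewrite ltnS => sn.
(* The indicator of the cluster of [u]: by [sep], this cluster is infinite as soon as it puts two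
   infinite components on different sides. *)
pose chi x := `[< conn (mono w) u x >].
have chiw x y : mono w x y -> chi x = chi y.
  by move=> /conn1 xy; apply: conn_eqr => //; exact: monoC.
have chiu : chi u by apply/asboolP; exact: conn_refl.
have [f fchi] := split_function Ow chiw.
have sep b1 x : infc (link b1 w) x -> side chi f b1 x != side chi f b' v ->
    infc (mono w) u.
  move=> ix /(side_sep chiw fchi ix iv) ic t.
  by have [y yt /asboolP] := ic t; exists y.
case: s us sv sn => [|x s] /=.
  move=> _ uv _; subst v; have [<-//|bb'] := eqVneq b b'.
  have b'E : b' = ~~ b by move: bb'; rewrite eq_sym; case: (b) (b') => [] [].
  rewrite b'E; apply: valC; apply: (sep b) => //.
  by rewrite b'E; exact: sideC.
move=> /andP[ux xs] sv sn.
(* If the path returns to the cluster of [u] at [y], restarting from [y] gives a shorter path from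
   the same component. *)
have [/hasP[y ys /asboolP uy]|/hasPn off] := boolP (has chi (x :: s)).
  have uy' : conn (link b w) u y by apply: conn_sub uy; exact: mono_link.
  rewrite (valc _ _ _ uy').
  have [s2 yv s2s] : exists2 t, path adj y t /\ last y t = v & (size t <= size s)%N.
    move: ys; rewrite inE => /orP[/eqP->|ys]; first by exists s.
    case/splitPr: ys xs sv => s1 s2; rewrite cat_path last_cat /= size_cat /=.
    by move=> /and3P[_ _ ?] ?; exists s2 => //; lia.
  case: yv => yv lv; apply: (IH s2) => //; last by lia.
  by apply: infc_conn iu => //; exact: linkC.
have step b1 : infc (link b1 w) x -> val b1 x = val b' v by move=> ix; exact: (IH s).
have [lux|] := boolP (link b w u x).
  rewrite (valc _ _ _ (conn1 lux)); apply: step.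
  by apply: infc_conn (conn1 lux) iu; exact: linkC.
move=> nlux; have := link_total b w ux; rewrite (negbTE nlux) /= => lux.
have icu : infc (mono w) u.
  apply: (sep b) => //.
  (* The rest of the path avoids the cluster, so [f] is constant along it, and the first step stays
     in a component of [link (~~ b)]. *)
  have -> : side chi f b' v = side chi f (~~ b) u; last exact: sideC.
  rewrite (side_link chiw fchi lux).
  have chix : ~~ chi x by apply: off; rewrite inE eqxx.
  rewrite (side_off _ _ chix) -sv.
  elim: s x xs off chix {sv IH sn step lux nlux ux} => [|y s IHs] x /=.
    by move=> _ _ chix; rewrite side_off.
  move=> /andP[xy ys] off chix.
  have chiy : ~~ chi y by apply: off; rewrite !inE eqxx orbT.
  rewrite (IHs y) //; last by move=> z zs; apply: off; rewrite inE zs orbT.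
  have := fchi _ _ xy; rewrite (negbTE chix) (negbTE chiy) andbF.
  by case: (f x) (f y) => [] [].
(* The cluster of [u] being infinite, the value can be transferred to the other graph, in which the
   step to [x] is an edge. *)
rewrite valC // (valc _ _ _ (conn1 lux)); apply: step.
apply: infc_conn (conn1 lux) _; first exact: linkC.
by apply: infc_sub icu; exact: mono_link.
Qed.

(** * Counting infinite components *)

Definition reps (e : rel vertex) (P : pred vertex) (s : seq vertex) : Prop :=
  [/\ uniq s, {in s, forall u, P u /\ infc e u} &
      {in s &, forall u v, conn e u v -> u = v}].

(** Counting by lower bounds makes sense even when the number is infinite, and requires only finite
    lists of representatives. *)
Definition atleast (e : rel vertex) (P : pred vertex) (k : nat) : Prop :=
  exists2 s, reps e P s & size s = k.

Definition complete (e : rel vertex) (P : pred vertex) (s : seq vertex) : Prop :=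
  reps e P s /\ forall u, P u -> infc e u -> exists2 v, v \in s & conn e u v.

Lemma atleast0 e P : atleast e P 0.
Proof. by exists [::]. Qed.

Lemma atleast_map (e e' : rel vertex) (P P' : pred vertex) (phi : vertex -> vertex) k :
  (forall u, P u -> infc e u -> P' (phi u) /\ infc e' (phi u)) ->
  (forall u v, P u -> infc e u -> P v -> infc e v ->
     conn e' (phi u) (phi v) -> conn e u v) ->
  atleast e P k -> atleast e' P' k.
Proof.
move=> phiP phic [s [us sP sinj] <-]; exists (map phi s); last exact: size_map.
have inj u v : u \in s -> v \in s -> conn e' (phi u) (phi v) -> u = v.
  by move=> us' vs c; apply: sinj => //; apply: phic c; apply sP.
split.
- rewrite map_inj_in_uniq // => u v us' vs uv; apply: inj => //.
  by rewrite uv; exact: conn_refl.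
- by move=> _ /mapP[u /sP[Pu iu] ->]; exact: phiP.
- by move=> _ _ /mapP[u us' ->] /mapP[v vs ->] c; rewrite (inj _ _ us' vs c).
Qed.

Lemma atleast_max e P k :
  ~ atleast e P k -> exists2 n, atleast e P n & ~ atleast e P n.+1.
Proof.
elim: k => [/(_ (atleast0 e P))//|k IH nk].
by have [ak|/IH] := pselect (atleast e P k); first by exists k.
Qed.

(** An infinite component missed by [s] would supply one more representative. *)
Lemma reps_complete (e : rel vertex) (P : pred vertex) s : symmetric e ->
  reps e P s -> ~ atleast e P (size s).+1 -> complete e P s.
Proof.
move=> eC sr max; split=> // u Pu iu; apply: contrapT => nu; apply: max.
have {}nu v : v \in s -> ~ conn e u v by move=> vs uv; apply: nu; exists v.
case: sr => us sP sinj; exists (u :: s) => //; split.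
- rewrite /= us andbT; apply/negP => /nu; apply; exact: conn_refl.
- by move=> v; rewrite inE => /orP[/eqP->//|/sP].
- move=> x y; rewrite !inE => /orP[/eqP->|xs] /orP[/eqP->|ys] //; last exact: sinj.
  + by move=> /(nu _ ys).
  + by move=> /(conn_sym eC)/(nu _ xs).
Qed.

Section Extension.
Variables (e : rel vertex) (P : pred vertex) (s : seq vertex).
Hypotheses (eC : symmetric e) (sr : reps e P s).

Definition extend (g : {ffun seq_sub s -> bool}) (v : vertex) : bool :=
  [exists x, `[< conn e v (ssval x) >] && g x].

Lemma extend_conn g u v : conn e u v -> extend g u = extend g v.
Proof. by move=> uv; apply: eq_existsb => x; rewrite (conn_eql _ _ uv). Qed.

Lemma extend_rep g v x : conn e v (ssval x) -> extend g v = g x.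
Proof.
move=> vx; rewrite (extend_conn _ vx); apply/existsP/idP => [[y]|gx]; last first.
  by exists x; rewrite gx andbT; apply/asboolP; exact: conn_refl.
case: sr => _ _ inj /andP[/asboolP xy]; suff -> : x = y by [].
by apply: val_inj; apply: inj xy; exact: ssvalP.
Qed.

End Extension.

(* The infinite components of [link true w] and [link false w] are the vertices
   of a finite tree whose edges are the infinite clusters. *)
Lemma tree_count (w : config) (s c d : seq vertex) : Omega w ->
  (0 < size s)%N -> complete (mono w) predT s ->
  complete (link true w) predT c -> complete (link false w) predT d ->
  (size c + size d)%N = (size s).+1.
Proof.
move=> Ow s0 [sr scov] [cr ccov] [dr dcov].
have lC b := linkC b w.
have r0 : seq_sub s.
  by case: s s0 {sr scov} => // x s _; exact: (SeqSub (mem_head x s)).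
have sinf (i : seq_sub s) : infc (mono w) (ssval i).
  by case: sr => _ /(_ _ (ssvalP i))[].
have linf b u : infc (mono w) u -> infc (link b w) u.
  by apply: infc_sub; exact: mono_link.
have mC b u v : conn (mono w) u v -> conn (link b w) u v.
  by apply: conn_sub; exact: mono_link.
pose A := ({ffun seq_sub c -> bool} * {ffun seq_sub d -> bool})%type.
pose B := ({ffun seq_sub s -> bool} * bool)%type.
pose vals (gh : A) b v :=
  if b then extend (link true w) gh.1 v else extend (link false w) gh.2 v.
have valsc gh b u v : conn (link b w) u v -> vals gh b u = vals gh b v.
  by case: b => uv; exact: extend_conn uv.
(* The Mayer-Vietoris difference map, completed by the value at a base point, which detects its
   kernel, the constants. Its bijectivity equates the cardinals 2^(c+d) and 2^(s+1). *)
pose Psi (gh : A) : B :=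
  ([ffun i => vals gh true (ssval i) (+) vals gh false (ssval i)],
   vals gh true (ssval r0)).
(* The difference [D] of two candidates agrees across infinite clusters, so [gluing] makes it
   constant on infinite components, equal to its value 0 at the base point. *)
have inj : injective Psi.
  move=> gh gh' [/ffunP E1].
  rewrite -/(vals gh true _) -/(vals gh' true _) => E2.
  pose D b v := vals gh b v (+) vals gh' b v.
  have Dc b u v : conn (link b w) u v -> D b u = D b v.
    by move=> uv; rewrite /D !(valsc _ _ _ _ uv).
  have Di u : infc (mono w) u -> D true u = D false u.
    move=> /scov[//|x xs ux].
    rewrite !(Dc _ u x); [|exact: mC|exact: mC].
    have : vals gh true x (+) vals gh false x = vals gh' true x (+) vals gh' false x.
      by have := E1 (SeqSub xs); rewrite !ffunE.
    rewrite /D; move: (vals gh true x) (vals gh false x).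
    move: (vals gh' true x) (vals gh' false x).
    by move=> [] [] [] [].
  have D0 b u : infc (link b w) u -> vals gh b u = vals gh' b u.
    move=> iu; have := gluing Ow Dc Di iu (linf true _ (sinf r0)).
    by rewrite /D E2 addbb; case: (vals gh b u) (vals gh' b u) => [] [].
  have e1 : gh.1 = gh'.1.
    apply/ffunP => x; have ix : infc (link true w) (ssval x).
      by case: cr => _ /(_ _ (ssvalP x))[].
    have := D0 true _ ix.
    by rewrite /vals !(extend_rep (lC true) cr _ (conn_refl _ _)).
  have e2 : gh.2 = gh'.2.
    apply/ffunP => x; have ix : infc (link false w) (ssval x).
      by case: dr => _ /(_ _ (ssvalP x))[].
    have := D0 false _ ix.
    by rewrite /vals !(extend_rep (lC false) dr _ (conn_refl _ _)).
  by case: gh gh' e1 e2 {E1 E2 D Dc Di D0} => [g h] [g' h'] /= -> ->.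
(* The data on infinite clusters, extended by [false] to the others, split into two sides; the
   constant [k] adjusts the value at the base point. *)
have surj y : exists x, Psi x = y.
  case: y => t b0.
  pose chi := extend (mono w) t.
  have chiw u v : mono w u v -> chi u = chi v.
    by move=> /conn1; apply: extend_conn; exact: monoC.
  have [f fchi] := split_function Ow chiw.
  pose S := side chi f; pose k := S true (ssval r0) (+) b0.
  pose gh : A := ([ffun x => S true (ssval x) (+) k],
                  [ffun x => S false (ssval x) (+) k]).
  have vS b u : infc (link b w) u -> vals gh b u = S b u (+) k.
    rewrite /vals; case: b => [/ccov|/dcov] [//|x xs ux].
      rewrite (extend_rep (lC true) cr _ (x := SeqSub xs) ux) ffunE /=.
      by congr (_ (+) _); apply/esym; exact: (side_conn chiw fchi).
    rewrite (extend_rep (lC false) dr _ (x := SeqSub xs) ux) ffunE /=.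
    by congr (_ (+) _); apply/esym; exact: (side_conn chiw fchi).
  exists gh; rewrite /Psi; congr pair; last first.
    by rewrite vS ?addKb //; apply: linf.
  apply/ffunP => i; rewrite ffunE !vS; [|exact: linf|exact: linf].
  have <- : chi (ssval i) = t i.
    by apply: extend_rep sr _ _ _ (conn_refl _ _); exact: monoC.
  have <- : S true (ssval i) (+) S false (ssval i) = chi (ssval i).
    by rewrite /S /side /=; case: (f _) (chi _) => [] [].
  by rewrite addbA addbAC addbK.
have [sigma sigmaK] := choice surj.
have card : #|{: A}| = #|{: B}|.
  apply/eqP; rewrite eqn_leq (leq_card _ inj) /=.
  exact: leq_card (can_inj sigmaK).
have [[us _ _] [uc _ _] [ud _ _]] := And3 sr cr dr.
move: card; rewrite !card_prod !card_ffun !card_bool !card_seq_sub //.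
by rewrite -expnD -expnSr => /eqP; rewrite eqn_exp2l // => /eqP.
Qed.

(** Once an infinite cluster exists, every infinite component of [link b] contains one. Hence
    finitely many infinite clusters leave finitely many infinite components. *)
Lemma atleast_link_mono (w : config) b k : Omega w ->
  atleast (mono w) predT 1 -> atleast (link b w) predT k ->
  atleast (mono w) predT k.
Proof.
move=> Ow [[|r [|//]] //[_ rP _] _].
have ir : infc (mono w) r by apply rP; rewrite inE.
have meets u : exists v, infc (link b w) u ->
    conn (link b w) u v /\ infc (mono w) v.
  have [iu|] := pselect (infc (link b w) u); last by exists u.
  apply: contrapT => /forallNP nv.
  (* Without an infinite cluster in the component of [u], its indicator, set to [false] on the other
     graph, would satisfy [gluing], which equates its value at [u] with the value [false] at [r]. *)
  pose val b' v := (b' == b) && `[< conn (link b w) u v >].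
  have valc b' x y : conn (link b' w) x y -> val b' x = val b' y.
    rewrite /val; case: eqP => //= -> xy; apply: conn_eqr => //; exact: linkC.
  have vali x : infc (mono w) x -> val true x = val false x.
    move=> ix; suff val0 b' : val b' x = false by rewrite !val0.
    by apply/negP => /andP[_ /asboolP ux]; apply: (nv x).
  have ir' : infc (link (~~ b) w) r by apply: infc_sub ir; exact: mono_link.
  have := gluing Ow valc vali iu ir'.
  rewrite /val eqxx; case: (b) => /=.
    by move/asboolP; apply; exact: conn_refl.
  by move/asboolP; apply; exact: conn_refl.
have [phi phiP] := choice meets.
apply: (atleast_map (phi := phi)) => [u _ /phiP[]//|u v _ iu _ iv c].
have [[uu _] [vv _]] := (phiP u iu, phiP v iv).
apply: conn_trans uu _; apply: conn_trans (conn_sym (@linkC b w) vv).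
by apply: conn_sub c; exact: mono_link.
Qed.

(** With [n] infinite clusters of each state and [m] infinite components in each graph, [tree_count]
    reads 2m = 2n + 1. *)
Lemma parity_obstruction (w : config) k : Omega w ->
  atleast (mono w) predT 1 -> ~ atleast (mono w) predT k ->
  (forall n, atleast (mono w) w n <-> atleast (mono w) (predC w) n) ->
  (forall n, atleast (link true w) predT n <-> atleast (link false w) predT n) ->
  False.
Proof.
move=> Ow a1 ak sym01 symL.
have bound P : ~ atleast (mono w) P k.
  by move=> aP; apply: ak; apply: (atleast_map (phi := id)) aP.
have [n [s sr sn] mn] := atleast_max (bound w).
have [[t tr tn] mn'] : atleast (mono w) (predC w) n /\ ~ atleast (mono w) (predC w) n.+1.
  by split; [apply/sym01; exists s | move/sym01].
have [m [c cr cm] mm] : exists2 n, atleast (link true w) predT n &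
    ~ atleast (link true w) predT n.+1.
  by apply: (@atleast_max _ _ k) => /(atleast_link_mono Ow a1).
have [[d dr dm] mm'] : atleast (link false w) predT m /\ ~ atleast (link false w) predT m.+1.
  by split; [apply/symL; exists c | move/symL].
have mC := @monoC w.
rewrite -sn in mn; rewrite -tn in mn'; rewrite -cm in mm; rewrite -dm in mm'.
have [_ scov] := reps_complete mC sr mn.
have [_ tcov] := reps_complete mC tr mn'.
have stc : complete (mono w) predT (s ++ t).
  split; last first.
    move=> u _ iu; case wu : (w u).
      by have [v vs uv] := scov u wu iu; exists v; rewrite // mem_cat vs.
    have [|v vt uv] := tcov u _ iu; first by rewrite /= wu.
    by exists v; rewrite // mem_cat vt orbT.
  have [[us sP sinj] [ut tP tinj]] := (sr, tr).
  have st u v : u \in s -> v \in t -> ~ conn (mono w) u v.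
    by move=> /sP[wu _] /tP[/negP wv _] /conn_mono_state e; apply: wv; rewrite -e.
  split.
  - rewrite cat_uniq us ut andbT /=; apply/hasPn => v vt; apply/negP => vs.
    by apply: (st v v) => //; exact: conn_refl.
  - by move=> u; rewrite mem_cat => /orP[/sP[]|/tP[]].
  - move=> u v; rewrite !mem_cat => /orP[us'|ut'] /orP[vs|vt] c0.
    + exact: sinj. + by case: (st u v). + by case: (st v u) => //; exact: conn_sym.
    + exact: tinj.
have st0 : (0 < size (s ++ t))%N.
  case: a1 => [[|r [|//]] //[_ rP _] _].
  have ir : infc (mono w) r by apply rP; rewrite inE.
  by have [v] := stc.2 r isT ir; case: (s ++ t).
have := tree_count Ow st0 stc (reps_complete (@linkC _ w) cr mm)
  (reps_complete (@linkC _ w) dr mm').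
by rewrite size_cat; lia.
Qed.

(** * Symmetries *)

Section Transport.
Variables (phi psi : vertex -> vertex).
Hypotheses (phiK : cancel phi psi) (psiK : cancel psi phi).

Lemma conn_map (e e' : rel vertex) u v : {homo phi : x y / e x y >-> e' x y} ->
  conn e u v -> conn e' (phi u) (phi v).
Proof.
move=> ee' [s us <-]; exists (map phi s); last by rewrite last_map.
by rewrite path_map; apply: sub_path us => x y; exact: ee'.
Qed.

Lemma atleast_iso (e e' : rel vertex) (P P' : pred vertex) k :
  (forall u v, e u v = e' (phi u) (phi v)) -> (forall u, P u = P' (phi u)) ->
  atleast e P k -> atleast e' P' k.
Proof.
move=> ee' PP'.
have hom : {homo phi : x y / e x y >-> e' x y} by move=> x y; rewrite ee'.
apply: (atleast_map (phi := phi)) => [u|u v _ _ _ _ [s]].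
  rewrite PP' => P'u iu; split=> // s; have [x xs ux] := iu (map psi s).
  exists (phi x); last exact: conn_map ux.
  by apply: contra xs => xs; rewrite -(phiK x) map_f.
elim: s u => [|x s IH] u /=; first by move=> _ /(can_inj phiK) ->; exact: conn_refl.
move=> /andP[ux xs] sv; apply: conn_trans (conn1 (v := psi x) _) (IH _ _ _).
- by rewrite ee' psiK.
- by rewrite psiK.
- by rewrite psiK.
Qed.

End Transport.

Definition shift (z v : vertex) : vertex := (v.1 + z.1, v.2 + z.2).

Definition unshift (z v : vertex) : vertex := (v.1 - z.1, v.2 - z.2).

Lemma shiftK z : cancel (shift z) (unshift z).
Proof. by move=> [m n]; rewrite /shift /unshift /= !addrK. Qed.

Lemma unshiftK z : cancel (unshift z) (shift z).
Proof. by move=> [m n]; rewrite /shift /unshift /= !subrK. Qed.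

Lemma adj_shift z u v : adj (shift z u) (shift z v) = adj u v.
Proof. by rewrite /adj /shift /=; congr (absz _ + absz _ == _)%N; lia. Qed.

(** The parity condition says that the translation preserves the colours of faces; odd coordinates
    then exchange the two types of white faces. *)
Lemma tau_shift z u v : par z.1 = par z.2 ->
  tau (shift z u) (shift z v) = tau u v (+) par z.1.
Proof.
move=> z12; rewrite /tau /shift /= -!addr_minl !par_add (inj_eq (addIr _)) z12.
by case: eqP; rewrite // addNb.
Qed.

Lemma mono_translate z w u v :
  mono (translate z w) u v = mono w (shift z u) (shift z v).
Proof. by rewrite /mono adj_shift. Qed.

Lemma link_translate b z w u v : par z.1 = par z.2 ->
  link b (translate z w) u v = link (b (+) par z.1) w (shift z u) (shift z v).
Proof.
move=> z12; rewrite /link adj_shift tau_shift //; congr (_ && (_ || _)).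
by case: b (tau u v) (par z.1) => [] [] [].
Qed.

Lemma atleast_mono_translate (P : bool -> bool) z w k :
  atleast (mono (translate z w)) (fun u => P (translate z w u)) k <->
  atleast (mono w) (fun u => P (w u)) k.
Proof.
split.
  by apply: (atleast_iso (@shiftK z) (@unshiftK z)) => u // v; exact: mono_translate.
apply: (atleast_iso (@unshiftK z) (@shiftK z)) => [u v|u].
  by rewrite mono_translate !unshiftK.
by rewrite -{1}(unshiftK z u).
Qed.

Lemma atleast_link_translate b z w k : par z.1 = par z.2 ->
  atleast (link b (translate z w)) predT k <->
  atleast (link (b (+) par z.1) w) predT k.
Proof.
move=> z12; split.
  by apply: (atleast_iso (@shiftK z) (@unshiftK z)) => u // v; exact: link_translate.
apply: (atleast_iso (@unshiftK z) (@shiftK z)) => u // v.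
by rewrite link_translate // !unshiftK.
Qed.

Lemma mono_flip w : mono (flip w) =2 mono w.
Proof. by move=> u v; rewrite /mono /flip (inj_eq negb_inj). Qed.

(** On the left, [~~ w u] is the state of [u] in [flip w]; for [P] the identity, the infinite
    1-clusters of [flip w] are matched with the infinite 0-clusters of [w]. *)
Lemma atleast_flip (P : bool -> bool) w k :
  atleast (mono (flip w)) (fun u => P (~~ w u)) k <->
  atleast (mono w) (fun u => P (~~ w u)) k.
Proof.
by split; apply: (@atleast_iso id id) => // u v; rewrite mono_flip.
Qed.

(** * Measurability *)

Section Measurability.
Implicit Types P Q : Config -> Prop.

Lemma measurable_ex (T : countType) (P : T -> Config -> Prop) :
  (forall t, measurable [set w | P t w]) ->
  measurable [set w | exists t, P t w].
Proof.
move=> mP; pose F n := if unpickle n is Some t then [set w | P t w] else set0.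
have -> : [set w | exists t, P t w] = \bigcup_n F n.
  apply/seteqP; split=> w /=; last first.
    by move=> [n _]; rewrite /F; case: unpickle => // t; exists t.
  by move=> [t Pt]; exists (pickle t) => //; rewrite /F pickleK.
by apply: bigcup_measurable => n _; rewrite /F; case: unpickle.
Qed.

Lemma measurable_not P : measurable [set w | P w] -> measurable [set w | ~ P w].
Proof. exact: measurableC. Qed.

Lemma measurable_and P Q : measurable [set w | P w] ->
  measurable [set w | Q w] -> measurable [set w | P w /\ Q w].
Proof. exact: measurableI. Qed.

Lemma measurable_or P Q : measurable [set w | P w] ->
  measurable [set w | Q w] -> measurable [set w | P w \/ Q w].
Proof. exact: measurableU. Qed.

Lemma measurable_prop (Q : Prop) : measurable [set w : Config | Q].
Proof.
have [q|q] := pselect Q.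
  by rewrite (_ : mkset _ = setT) //; apply/seteqP; split.
by rewrite (_ : mkset _ = set0) //; apply/seteqP; split.
Qed.

Lemma measurable_imp P Q : measurable [set w | P w] ->
  measurable [set w | Q w] -> measurable [set w | P w -> Q w].
Proof.
move=> mP mQ; rewrite (_ : mkset _ = [set w | ~ P w \/ Q w]).
  by apply: measurable_or => //; exact: measurable_not.
apply/seteqP; split=> w /=; last by move=> [nP /nP|].
by move=> PQ; have [/PQ|] := pselect (P w); [right | left].
Qed.

Lemma measurable_all (T : countType) (P : T -> Config -> Prop) :
  (forall t, measurable [set w | P t w]) ->
  measurable [set w | forall t, P t w].
Proof.
move=> mP; rewrite (_ : mkset _ = [set w | ~ exists t, ~ P t w]).
  by apply: measurable_not; apply: measurable_ex => t; exact: measurable_not.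
apply/seteqP; split=> w /= => [Pw [t]|nP t]; first exact.
by apply: contrapT => nPt; apply: nP; exists t.
Qed.

Lemma measurable_state v b : measurable [set w : Config | w v = b].
Proof.
suff : cylinders [set w | w v = b] by exact: (@sub_sigma_algebra _ setT).
by exists v, b.
Qed.

(** Events depending on finitely many states. Below, [F] reads the states by [nth] within the length
    of the list, so its default is never returned. *)
Lemma measurable_local (vs : seq vertex) (F : seq bool -> bool) :
  measurable [set w : Config | F (map w vs)].
Proof.
elim: vs F => [|v vs IH] F /=; first exact: measurable_prop.
rewrite (_ : mkset _ =
    [set w | exists b, w v = b /\ F (b :: map w vs)]); last first.
  by apply/seteqP; split=> w /=; [exists (w v) | move=> [b [->]]].
apply: measurable_ex => b; apply: measurable_and; first exact: measurable_state.
exact: (IH (fun bs => F (b :: bs))).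
Qed.

Lemma measurable_mono u v : measurable [set w : Config | mono w u v].
Proof.
exact: (measurable_local [:: u; v]
  (fun bs => adj u v && (nth true bs 0 == nth true bs 1))).
Qed.

Lemma measurable_link b u v : measurable [set w : Config | link b w u v].
Proof.
exact: (measurable_local [:: u; v]
  (fun bs => adj u v && ((nth true bs 0 == nth true bs 1) || (tau u v == b)))).
Qed.

Lemma measurable_Omega : measurable (Omega : set Config).
Proof.
apply: measurable_all => m; apply: measurable_all => n.
apply: measurable_imp; first exact: measurable_prop.
exact: (measurable_local [:: (m, n); (m, n + 1); (m + 1, n + 1); (m + 1, n)]
  (fun bs => allowed (nth true bs 0) (nth true bs 1) (nth true bs 2) (nth true bs 3))).
Qed.

Lemma measurable_atleast (e : Config -> rel vertex) (P : Config -> pred vertex) k :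
  (forall u v, measurable [set w | e w u v]) ->
  (forall u, measurable [set w | P w u]) ->
  measurable [set w | atleast (e w) (P w) k].
Proof.
move=> me mP.
have mpath s : forall u, measurable [set w | path (e w) u s].
  elim: s => [|x s IH] u /=; first exact: measurable_prop.
  rewrite (_ : mkset _ = [set w | e w u x /\ path (e w) x s]).
    exact: measurable_and.
  by apply/seteqP; split=> w /= /andP.
have mconn u v : measurable [set w | conn (e w) u v].
  rewrite (_ : mkset _ = [set w | exists s, path (e w) u s /\ last u s = v]).
    apply: measurable_ex => s; apply: measurable_and => //; exact: measurable_prop.
  by apply/seteqP; split=> w [s]; [exists s | move=> []; exists s].
have minf u : measurable [set w | infc (e w) u].
  apply: measurable_all => s.
  rewrite (_ : mkset _ = [set w | exists x, x \notin s /\ conn (e w) u x]).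
    apply: measurable_ex => x; apply: measurable_and => //; exact: measurable_prop.
  by apply/seteqP; split=> w [x]; [exists x | move=> []; exists x].
rewrite (_ : mkset _ = [set w | exists s, [/\ uniq s /\ size s = k,
    forall u, u \in s -> P w u /\ infc (e w) u &
    forall u v, u \in s -> v \in s -> conn (e w) u v -> u = v]]); last first.
  apply/seteqP; split=> w.
    by move=> [s [us sP sinj] sk]; exists s.
  by move=> [s [[us sk] sP sinj]]; exists s.
apply: measurable_ex => s.
rewrite (_ : mkset _ = [set w | (uniq s /\ size s = k) /\
    (forall u, u \in s -> P w u /\ infc (e w) u) /\
    forall u v, u \in s -> v \in s -> conn (e w) u v -> u = v]); last first.
  by apply/seteqP; split=> w [] // ? [].
apply: measurable_and; first exact: measurable_prop.
apply: measurable_and.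
  apply: measurable_all => u; apply: measurable_imp; first exact: measurable_prop.
  exact: measurable_and.
apply: measurable_all => u; apply: measurable_all => v.
do 2 (apply: measurable_imp; first exact: measurable_prop).
by apply: measurable_imp => //; exact: measurable_prop.
Qed.

End Measurability.

(** * Infinite clusters *)

Lemma same_clusterE w u v : same_cluster w u v <-> conn (mono w) u v.
Proof.
split=> [[s [us [<- sw]]]|[s us sv]].
  exists s => //; elim: s u us sw => //= x s IH u /andP[ux xs] /andP[/eqP xu sw].
  by rewrite /mono ux xu eqxx /=; apply: IH; rewrite // xu.
exists s; elim: s u us sv => //= x s IH u /andP[/andP[ux /eqP uw] xs] sv.
have [ps [ls sw]] := IH x xs sv; rewrite ux ps uw eqxx; split=> //; split=> //.
Qed.

Lemma finite_setNinfset (A : set vertex) : ~ finite_set A <-> infset A.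
Proof.
split=> [nA s|iA /finite_seqP[s As]].
  apply: contrapT => ns; apply: nA; apply: (@sub_finite_set _ _ [set` s]) => // v Av.
  by apply: contrapT => /negP vs; apply: ns; exists v.
by have [v /negP vs] := iA s; rewrite As.
Qed.

Definition cluster_of (w : config) (u : vertex) : set vertex :=
  [set v | same_cluster w u v].

Lemma infinite_clusterP w u : infinite_clusters w (cluster_of w u) <-> infc (mono w) u.
Proof.
have iE : infset (cluster_of w u) <-> infc (mono w) u.
  by split=> iu s; have [v vs /same_clusterE uv] := iu s; exists v.
split=> [[_ /finite_setNinfset/iE] //|/iE/finite_setNinfset iu].
by split=> //; exists u.
Qed.

Lemma cluster_of_eq w u v : conn (mono w) u v <-> cluster_of w u = cluster_of w v.
Proof.
split=> [uv|uv]; last first.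
  have : cluster_of w v v by apply/same_clusterE; exact: conn_refl.
  by rewrite -uv => /same_clusterE.
apply/seteqP; split=> x /same_clusterE c; apply/same_clusterE.
  exact: conn_trans (conn_sym (@monoC w) uv) c.
exact: conn_trans uv c.
Qed.

(** Replaces sets of clusters by lists of representatives, the form required by both measurability
    and the tree count. *)
Lemma event_AP w : event_A w <->
  atleast (mono w) predT 1 /\ exists k, ~ atleast (mono w) predT k.
Proof.
split.
  move=> [[C iC] /finite_seqP[S SE]]; split.
    move: (iC) => [[u CE] _]; exists [:: u] => //; split=> //.
      by move=> v; rewrite inE => /eqP->; split=> //; apply/infinite_clusterP; rewrite /cluster_of -CE.
    by move=> x y; rewrite !inE => /eqP-> /eqP->.
  exists (size S).+1 => -[t [ut tP tinj] tS].
  have : (size (map (cluster_of w) t) <= size S)%N.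
    apply: uniq_leq_size => [|_ /mapP[u /tP[_ /infinite_clusterP iu] ->]]; last first.
      by have : infinite_clusters w (cluster_of w u) by []; rewrite SE.
    rewrite map_inj_in_uniq // => u v us vs /cluster_of_eq; exact: tinj.
  by rewrite size_map tS ltnn.
move=> [[s [_ sP _] s1] [k /atleast_max[n [t tr tn] mn]]]; split.
  case: s s1 sP => // u s _ /(_ u (mem_head _ _))[_ /infinite_clusterP iu].
  by exists (cluster_of w u).
rewrite -tn in mn; have [_ tcov] := reps_complete (@monoC w) tr mn.
apply: (@sub_finite_set _ _ [set` map (cluster_of w) t]); last exact: finite_seq.
move=> C iC; have [[u CE] _] := iC.
have iu : infc (mono w) u by apply/infinite_clusterP; rewrite /cluster_of -CE.
have [v vt /cluster_of_eq uv] := tcov u isT iu.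
by rewrite /= CE -/(cluster_of w u) uv map_f.
Qed.

Lemma measurable_event_A : measurable (event_A : set Config).
Proof.
have m k : measurable [set w : Config | atleast (mono w) predT k].
  by apply: measurable_atleast => [|u]; [exact: measurable_mono | exact: measurable_prop].
rewrite (_ : event_A = [set w | atleast (mono w) predT 1 /\
    exists k, ~ atleast (mono w) predT k]); last first.
  by apply/seteqP; split=> w /event_AP.
by apply: measurable_and => //; apply: measurable_ex => k; exact: measurable_not.
Qed.

(** * From equal probabilities to almost sure equivalences *)

Section AlmostSure.
Variables (R : realType) (mu : probability Config R).

Lemma ae_prob1 (X : set Config) : measurable X -> mu X = 1%E ->
  {ae mu, forall w, X w}.
Proof.
move=> mX X1; apply/negligibleP; first exact: measurableC.
by apply: (etrans (probability_setC mu mX)); rewrite X1 subee.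
Qed.

Lemma ae_iff (X Y : set Config) : measurable X -> measurable Y ->
  mu X = mu Y -> mu X = 0%E \/ mu X = 1%E -> {ae mu, forall w, X w <-> Y w}.
Proof.
move=> mX mY XY [X0|X1].
  have nX : mu.-negligible X by apply/negligibleP.
  have nY : mu.-negligible Y by apply/negligibleP => //; exact: etrans (esym XY) X0.
  apply: negligibleS (negligibleU nX nY) => w /= nXY.
  apply: contrapT => /not_orP[nx ny]; apply: nXY.
  by split=> [/nx|/ny].
have := ae_prob1 mX X1; have := ae_prob1 mY (etrans (esym XY) X1).
by apply: filterS2 => w; split.
Qed.

End AlmostSure.

Theorem theorem1p1 (R : realType) (mu : probability Config R)
  (hOmega : mu Omega = 1%E)
  (hA1 : forall (a b : int) (A : set Config), measurable A ->
     mu (translate (a + b, a - b) @^-1` A) = mu A)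
  (hA2 : forall A : set Config, measurable A ->
     (forall m n : int, translate (2 * m, 2 * n) @^-1` A = A) ->
     mu A = 0%E \/ mu A = 1%E)
  (hA3 : forall A : set Config, measurable A -> mu (flip @^-1` A) = mu A) :
  mu event_A = 0%E.
Proof.
have par2 (m : int) : par (2 * m) = false.
  by rewrite mulrDl mul1r par_add addbb.
have par_even m n : par (2 * m, 2 * n).1 = par (2 * m, 2 * n).2 by rewrite !par2.
have invA m n : translate (2 * m, 2 * n) @^-1` event_A = event_A.
  have inv k w := atleast_mono_translate (fun=> true) (2 * m, 2 * n) w k.
  apply/seteqP; split=> w /event_AP[a1 [k ak]]; apply/event_AP.
    by split; [apply/(inv 1%N w) | exists k => /(inv k w)].
  by split; [apply/(inv 1%N w) | exists k => /(inv k w)].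
have [//|A1] := hA2 _ measurable_event_A invA.
(* [X false] counts infinite 1-clusters and [X true] infinite 0-clusters. *)
pose X (b : bool) n : set Config :=
  [set w | atleast (mono w) (fun u => b (+) w u) n].
pose L b n : set Config := [set w | atleast (link b w) predT n].
have mX b n : measurable (X b n).
  apply: measurable_atleast => [|u]; first exact: measurable_mono.
  exact: (measurable_local [:: u] (fun bs => b (+) nth true bs 0)).
have mL b n : measurable (L b n).
  by apply: measurable_atleast => [|u]; [exact: measurable_link | exact: measurable_prop].
have symX : {ae mu, forall w n, X false n w <-> X true n w}.
  apply/ae_foralln => n; apply: ae_iff => //.
    rewrite -(hA3 _ (mX false n)); congr (mu _); apply/seteqP.
    by split=> w /=; move/(atleast_flip id w n).
  apply: hA2 => // p q; apply/seteqP.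
  by split=> w; move/(atleast_mono_translate (addb false) (2 * p, 2 * q) w n).
have symL : {ae mu, forall w n, L true n w <-> L false n w}.
  apply/ae_foralln => n; apply: ae_iff => //.
    (* This is the translation by (1,1), whose odd coordinates exchange the two graphs. *)
    rewrite -(hA1 1 0 _ (mL true n)); congr (mu _); apply/seteqP.
    by split=> w /=; move/(@atleast_link_translate true (1 + 0, 1 - 0) w n erefl).
  apply: hA2 => // p q; apply/seteqP.
  have inv w := @atleast_link_translate true _ w n (par_even p q).
  by split=> w; move: (inv w); rewrite par2 /= => h /h.
have FF : Filter (almost_everywhere mu) := ae_filter_ringOfSetsType mu.
(* If [event_A] had probability 1, almost every configuration would satisfy the hypotheses of
   [parity_obstruction], and the whole space would be null. *)
have : {ae mu, forall w, False}.
  have OA : {ae mu, forall w, Omega w /\ event_A w}.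
    have := ae_prob1 measurable_event_A A1.
    have := ae_prob1 measurable_Omega hOmega.
    by apply: filterS2 => w; split.
  apply: filterS3 OA symX symL => w [Ow /event_AP[a1 [k ak]]] Xw Lw.
  by apply: (parity_obstruction Ow a1 ak) => n; [exact: Xw | exact: Lw].
move=> nT; have T0 : mu setT = 0%E by apply/negligibleP => //; rewrite -setC0.
have /eqP := etrans (esym T0) (probability_setT mu).
by rewrite eqe eq_sym oner_eq0.
Qed.
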